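(* Let $\mathcal X_{post}\subseteq\mathcal X$ be the deviation set for the post estimate $\hat\beta_{post}$, and let $CI_\alpha(X,\tilde{\mathcal X})$ be a confidence interval procedure which delivers valid conditional coverage given $X\in\tilde{\mathcal X}$, i.e., for (measurable) $\tilde{\mathcal X}\subseteq\mathcal X$, $$\Pr_\beta\left(l'\beta_{post}\in CI_\alpha(X,\tilde{\mathcal X})\mid X\in\tilde{\mathcal X}\right)\ge1-\alpha\quad\text{for all }\beta .$$ Let $\{\mathcal X_m\}_{m=1}^M$ be a partition of $\mathcal X_{post}$, i.e., $\bigcup_m\mathcal X_m=\mathcal X_{post}$ and $\mathcal X_m\cap\mathcal X_{m'}=\varnothing$ for all $m\ne m'$, and define the ''local report function'' $\tilde{\mathcal X}_{post}:\mathcal X_{post}\to\{\mathcal X_1,\dots,\mathcal X_M\}$ by $\tilde{\mathcal X}_{post}(X)=\mathcal X_m$ if $X\in\mathcal X_m$. Then $CI_\alpha(X,\tilde{\mathcal X}_{post}(X))$ delivers valid conditional coverage given $X\in\mathcal X_{post}$: $$\Pr_\beta\left(l'\beta_{post}\in CI_\alpha(X,\tilde{\mathcal X}_{post}(X))\mid X\in\mathcal X_{post}\right)\ge1-\alpha\quad\text{for all }\beta .$$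
   Context: Data $X$ take values in a sample space $\mathcal X$. A vector of estimates $\hat\beta$, a function of $X$, satisfies $\hat\beta\sim N(\beta,\Sigma)$ with unknown mean $\beta$ and known positive definite covariance matrix $\Sigma$; $\Pr_\beta$ denotes probability under mean $\beta$. $\hat\beta_{post}$ is a subvector of $\hat\beta$ with mean $\beta_{post}$ (the corresponding subvector of $\beta$), and $l\ne0$ is a fixed vector, so $l'\beta_{post}$ is a fixed linear function of $\beta$. The deviation set $\mathcal X_{post}$ is the set of data realizations in which the researcher reports $\hat\beta_{post}$. A confidence interval procedure $CI_\alpha(\cdot,\cdot)$ takes as input the data $X$ and a conditioning set $\tilde{\mathcal X}\subseteq\mathcal X$ and returns an interval in $\mathbb R$; $\alpha\in(0,1)$. All sets and events are assumed measurable, and each conditional-probability statement is understood for those $\beta$ under which the conditioning event has positive probability. *)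

(* Defs.v *)
From mathcomp Require Import all_boot all_order all_algebra.
From mathcomp Require Import all_classical all_reals all_analysis.

Set Implicit Arguments.
Unset Strict Implicit.
Unset Printing Implicit Defensive.

Import Order.TTheory GRing.Theory Num.Theory.
Import numFieldNormedType.Exports.

Local Open Scope classical_set_scope.
Local Open Scope ring_scope.

Definition dotv (R : realType) (n : nat) (u v : 'cV[R]_n) : R :=
  (u^T *m v) 0 0.

Definition posdefmx (R : realType) (n : nat) (S : 'M[R]_n) : Prop :=
  S^T = S /\ forall c : 'cV[R]_n, c != 0 -> 0 < dotv c (S *m c).

(* [Y ~ N(mu, S)] under [P], in the usual sense that every linear combination
   of the coordinates is univariate normal with the matching mean and variance.
   The second parameter of [normal_prob] is the standard deviation. The case
   [c = 0] carries no information, and is left out because [normal_prob m 0]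
   is not the Dirac mass at [m] but a junk value; for [c != 0] and [S] positive
   definite the standard deviation is positive. *)
Definition is_mvnormal (d : measure_display) (T : measurableType d)
    (R : realType) (P : probability T R) (n : nat) (Y : T -> 'cV[R]_n)
    (mu : 'cV[R]_n) (S : 'M[R]_n) : Prop :=
  (forall i : 'I_n, measurable_fun [set: T] (fun x => Y x i 0)) /\
  forall c : 'cV[R]_n, c != 0 -> forall B : set R, measurable B ->
    P [set x | B (dotv c (Y x))] =
      normal_prob (dotv c mu) (Num.sqrt (dotv c (S *m c))) B.

(* The subvector of [v] with coordinates in [s], in increasing order. *)
Definition subvec (R : realType) (n : nat) (s : {set 'I_n}) (v : 'cV[R]_n) :
    'cV[R]_#|s| :=
  \col_(i < #|s|) v (enum_val i) 0.

(* [reports x s] means that on data [x] the researcher reports the subvector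
   of the estimates with coordinates in [s]. *)
Definition deviation_set (T : Type) (n : nat)
    (reports : T -> {set 'I_n} -> Prop) (post : {set 'I_n}) : set T :=
  [set x | reports x post].

(* Equal to 0 when [P B = 0]; only used for events [B] with [0 < P B]. *)
Definition cond_prob (d : measure_display) (T : measurableType d)
    (R : realType) (P : probability T R) (A B : set T) : R :=
  fine (P (A `&` B)) / fine (P B).

Definition valid_cond_coverage (d : measure_display) (T : measurableType d)
    (R : realType) (n : nat) (Pr : 'cV[R]_n -> probability T R)
    (theta : 'cV[R]_n -> R) (alpha : R) (I : T -> interval R) (A : set T) :
    Prop :=
  forall beta : 'cV[R]_n, (0 < Pr beta A)%E ->
    1 - alpha <= cond_prob (Pr beta) [set x | theta beta \in I x] A.

(* Empty cells are allowed, so this is not [classical_sets.partition]. *)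
Definition is_partition (T : Type) (M : nat) (cell : 'I_M -> set T)
    (A : set T) : Prop :=
  \bigcup_(m in [set: 'I_M]) cell m = A /\
  forall m m' : 'I_M, m <> m' -> cell m `&` cell m' = set0.

(* The local report function has domain [\bigcup_m cell m]; it is represented
   by a total function whose values outside this domain are arbitrary. *)
Definition is_local_report (T : Type) (M : nat) (cell : 'I_M -> set T)
    (rep : T -> set T) : Prop :=
  forall (m : 'I_M) (x : T), cell m x -> rep x = cell m.

(* Main.v *)
Require Import Defs.
From mathcomp Require Import all_boot all_order all_algebra.
From mathcomp Require Import all_classical all_reals all_analysis.

Import Order.TTheory GRing.Theory Num.Theory.
Import numFieldNormedType.Exports.

Local Open Scope classical_set_scope.
Local Open Scope ring_scope.

(** On the cell [cell m] the local report is constantly [cell m], so there the reported interval is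
    the one computed with conditioning set [cell m], which covers with conditional probability at
    least [1 - alpha]. The law of total probability averages these bounds over the finitely many
    disjoint cells. [le_cond_probP] trades each conditional bound for a product inequality, and
    [le_cond_prob_bigcup] sums these. *)

(* Multiplied out by [P B], the coverage bound needs no [0 < P B] and adds up
   over the cells. *)
Lemma le_cond_probP (d : measure_display) (T : measurableType d)
    (R : realType) (P : probability T R) (A B : set T) (p : R) :
    measurable B -> measurable (A `&` B) ->
  ((0 < P B)%E -> p <= cond_prob P A B) <-> (p%:E * P B <= P (A `&` B))%E.
Proof.
move=> mB mAB.
have finB : P B \is a fin_num by exact: fin_num_measure.
have finAB : P (A `&` B) \is a fin_num by exact: fin_num_measure.
have -> : (p%:E * P B <= P (A `&` B))%E =
          (p * fine (P B) <= fine (P (A `&` B))).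
  by rewrite -(fineK finB) -(fineK finAB) -EFinM lee_fin !fineK.
rewrite /cond_prob; have := measure_ge0 P B; rewrite le_eqVlt.
(* For a null [B] the left side is vacuous and the right side reads [0 <= P (A]&[B)]. *)
case/orP => [/eqP PB0 | PB_gt0].
  by rewrite -PB0 ltxx mulr0; split=> // _; rewrite fine_ge0.
rewrite PB_gt0 ler_pdivlMr; last first.
  by rewrite fine_gt0// PB_gt0 ltey_eq finB.
by split=> // /(_ isT).
Qed.

(** Both [P (\bigcup_i cell i)] and the probability of its intersection with [E] are finite sums
    over the cells, so the product inequalities add up term by term. Null cells contribute
    trivially. *)
Lemma le_cond_prob_bigcup (d : measure_display) (T : measurableType d)
    (R : realType) (P : probability T R) (I : finType) (cell : I -> set T)
    (E : set T) (p : R) :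
    trivIset setT cell -> (forall i, measurable (cell i)) ->
    (forall i, measurable (E `&` cell i)) ->
    (forall i, (0 < P (cell i))%E -> p <= cond_prob P E (cell i)) ->
  (0 < P (\bigcup_i cell i))%E -> p <= cond_prob P E (\bigcup_i cell i).
Proof.
move=> tcell mcell mEcell cov.
have finI : finite_set [set: I] by exact: finite_finset.
have tEcell : trivIset setT (fun i => E `&` cell i).
  exact: (trivIset_setIl (G := fun=> E)).
apply/le_cond_probP.
- exact: fin_bigcup_measurable.
- by rewrite setI_bigcupr; exact: fin_bigcup_measurable.
(* The factor [p] may have any sign: it distributes because the summands [P (cell i)] are
   nonnegative. *)
rewrite setI_bigcupr !measure_fin_bigcup// ge0_mule_fsumr//.
apply: lee_fsum => // i _.
by apply: (le_cond_probP _ _ _ _ _ _ p (mcell i) (mEcell i)).1; exact: cov.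
Qed.

Theorem proposition5
  (R : realType) (d : measure_display) (X : measurableType d)
  (n : nat) (Pr : 'cV[R]_n -> probability X R)
  (hatbeta : X -> 'cV[R]_n) (Sigma : 'M[R]_n)
  (hSigma : posdefmx Sigma)
  (hhatbeta : forall beta : 'cV[R]_n, is_mvnormal (Pr beta) hatbeta beta Sigma)
  (post : {set 'I_n}) (l : 'cV[R]_#|post|) (hl : l != 0)
  (reports : X -> {set 'I_n} -> Prop)
  (hXpost : measurable (deviation_set reports post))
  (alpha : R) (halpha : 0 < alpha < 1)
  (CI : X -> set X -> interval R)
  (hCImeas : forall (A : set X) (beta : 'cV[R]_n), measurable A ->
     measurable (A `&` [set x | dotv l (subvec post beta) \in CI x A]))
  (hCI : forall A : set X, measurable A ->
     valid_cond_coverage Pr (fun beta => dotv l (subvec post beta)) alpha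
       (fun x => CI x A) A)
  (M : nat) (cell : 'I_M -> set X)
  (hcellmeas : forall m : 'I_M, measurable (cell m))
  (hcell : is_partition cell (deviation_set reports post))
  (localrep : X -> set X) (hlocalrep : is_local_report cell localrep) :
  valid_cond_coverage Pr (fun beta => dotv l (subvec post beta)) alpha
    (fun x => CI x (localrep x)) (deviation_set reports post).
Proof.
have [cellU celldisj] := hcell.
have tcell : trivIset setT cell.
  by apply/trivIsetP => i j _ _ /eqP; exact: celldisj.
move=> beta; set E := [set x | _ \in CI x (localrep x)].
(* The varying conditioning set [localrep x] becomes the fixed set [cell m], to which [hCImeas] and
   [hCI] apply. *)
have E_cell m : E `&` cell m =
    [set x | dotv l (subvec post beta) \in CI x (cell m)] `&` cell m.
  by apply/seteqP; split=> x [Ex cx]; split=> //; move: Ex;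
    rewrite /E /= (hlocalrep m x cx).
have mE_cell m : measurable (E `&` cell m).
  by rewrite E_cell setIC; exact: hCImeas.
rewrite -cellU; apply: le_cond_prob_bigcup => //.
move=> m Pm_gt0; rewrite /cond_prob E_cell; exact: hCI.
Qed.
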